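(* Let $r\geq 4$ and let $\mathcal{H}$ be a $2$-reducible $r$-tree with $\sigma=\sigma(\mathcal{H})$. Then $\mathrm{ex}(n,\mathcal{H})\leq(\sigma-1)\binom{n}{r-1}+O(n^{r-2})$ as $n\to\infty$.
   Context: An $r$-tree is an $r$-uniform hypergraph whose edges can be ordered $E_1,\dots,E_m$ so that for each $i>1$ there is $\alpha(i)<i$ with $E_i\cap\bigcup_{j<i}E_j\subseteq E_{\alpha(i)}$; it is $2$-reducible if each edge contains at least $2$ vertices of degree $1$. A cross-cut is a vertex set meeting each edge in exactly one vertex; $\sigma(\mathcal{H})$ is the minimum size of a cross-cut. $\mathrm{ex}(n,\mathcal{H})$ is the maximum number of edges of an $n$-vertex $r$-uniform hypergraph not containing $\mathcal{H}$. *)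

(* Defs.v *)
From mathcomp Require Import all_boot.

Set Implicit Arguments.
Unset Strict Implicit.
Unset Printing Implicit Defensive.

(* A hypergraph on the vertex type V is given by its set of edges. *)

Definition uniform (V : finType) (r : nat) (H : {set {set V}}) : bool :=
  [forall E in H, #|E| == r].

Definition degree (V : finType) (H : {set {set V}}) (v : V) : nat :=
  #|[set E in H | v \in E]|.

(* Edges are numbered from 0 here.  A tree has at least one edge. *)
Definition is_rtree (V : finType) (r : nat) (H : {set {set V}}) : Prop :=
  [/\ uniform r H, H != set0 &
    exists s : seq {set V},
      [/\ uniq s, s =i H &
        forall i : nat, 0 < i < size s ->
          exists2 a : nat, a < i &
            nth set0 s i :&: \bigcup_(j < i) nth set0 s j
              \subset nth set0 s a]].

Definition two_reducible (V : finType) (H : {set {set V}}) : bool :=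
  [forall E in H, 2 <= #|[set v in E | degree H v == 1]|].

Definition crosscut (V : finType) (H : {set {set V}}) (S : {set V}) : bool :=
  [forall E in H, #|S :&: E| == 1].

(* The default value #|V| bounds the size of every cross-cut, so this is the
   minimum size as soon as a cross-cut exists; in a 2-reducible hypergraph
   one is obtained by choosing a vertex of degree 1 in each edge. *)
Definition sigma (V : finType) (H : {set {set V}}) : nat :=
  \big[minn/#|V|]_(S : {set V} | crosscut H S) #|S|.

(* Containment as a not necessarily induced subhypergraph. *)
Definition contains (V W : finType) (F : {set {set W}}) (H : {set {set V}}) :
    bool :=
  [exists f : {ffun V -> W},
    injectiveb f && [forall E in H, f @: (E : {set V}) \in F]].

Definition turan_ex (V : finType) (r n : nat) (H : {set {set V}}) : nat :=
  \max_(F : {set {set 'I_n}} | uniform r F && ~~ contains F H) #|F|.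

(* Main.v *)
Require Import Defs.
From mathcomp Require Import all_boot.

Set Implicit Arguments.
Unset Strict Implicit.
Unset Printing Implicit Defensive.

(* Let F be H-free and k = sigma(H). Deleting the edges through (r-1)-sets of
   degree < k costs at most (k-1) C(n,r-1) edges. In the remaining F' every
   shadow set D has k extension vertices c_1(D), ..., c_k(D), and
   |F'| = O(|shadow F'|), since otherwise H embeds greedily. It remains to bound
   the number of ordered shadow sets D by O(n^(r-2)). For a position p and an
   index j, either some nonempty subfamily has large degrees and, for each of
   its D, many values c_j(D') among the D' agreeing with D off p; or, up to
   O(n^(r-2)) sets, there are few such values. In the first case H embeds in
   the edges D + c_j(D), two degree-1 vertices of each edge going to the vertex
   in position p and to c_j(D). If the second case holds for all p and j, then
   unless only O(n^(r-2)) sets are left, some value (c_1, ..., c_k) is taken by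
   a family of D with large degrees: a minimum cross-cut S goes to c_1, ..., c_k
   and the traces E \ S embed greedily in that family. *)

(** * Embedding hypertrees greedily *)

(** [X] is matched with elements of [Y] in enumeration order. In use, [A] is the part already placed
    and [X] consists of new vertices. *)
Lemma extend_injection (V W : finType) (f : V -> W) (A X : {set V})
    (Y : {set W}) :
    {in A &, injective f} -> [disjoint A & X] -> [disjoint f @: A & Y] ->
    #|X| <= #|Y| ->
  exists f' : V -> W,
    [/\ {in A, f' =1 f}, f' @: X \subset Y & {in A :|: X &, injective f'}].
Proof.
move=> injf dAX dAY leXY.
have szX v : v \in X -> index v (enum X) < size (enum Y).
  by move=> Xv; rewrite -cardE (leq_trans _ leXY) // cardE index_mem mem_enum.
pose f' v := if v \in X then nth (f v) (enum Y) (index v (enum X)) else f v.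
have f'A : {in A, f' =1 f}.
  by move=> v Av; rewrite /f' (disjointFr dAX Av).
have f'X v : v \in X -> f' v \in Y.
  by move=> Xv; rewrite /f' Xv -mem_enum mem_nth // szX.
exists f'; split=> // [|u v].
  by apply/subsetP => _ /imsetP[v Xv ->]; apply: f'X.
have AX a x : a \in A -> x \in X -> f' a = f' x -> a = x.
  move=> Aa Xx e; have := disjointFr dAY (imset_f f Aa).
  by rewrite -f'A // e f'X.
rewrite !inE => /orP[Au|Xu] /orP[Av|Xv] e.
- by apply: injf => //; rewrite -!f'A.
- exact: AX e.
- by apply/esym/AX.
move: e; rewrite /f' Xu Xv (set_nth_default (f v)) ?szX //.
move/eqP; rewrite nth_uniq ?szX ?enum_uniq // => /eqP e.
rewrite -(nth_index u (s := enum X) (x := u)) ?mem_enum // e.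
by rewrite nth_index ?mem_enum.
Qed.

(* Labelled edges are maps from a type [I] of positions. The positions in [Q0]
   must always move: they will carry degree-1 vertices. *)
Definition refreshable (I W : finType) (T : {set {ffun I -> W}}) (Q0 : {set I})
    (N : nat) : Prop :=
  forall (g : {ffun I -> W}) (Q : {set I}) (U : {set W}),
    g \in T -> Q0 \subset Q -> #|U| <= N ->
  exists2 g' : {ffun I -> W}, g' \in T &
    forall i, if i \in Q then g' i \notin U else g' i == g i.

(** The positions of [Q] are moved one after the other: a move changes no other position, so those
    already moved stay outside [U]. *)
Lemma refreshable_pointwise (I W : finType) (T : {set {ffun I -> W}}) N :
    (forall (g : {ffun I -> W}) p (U : {set W}), g \in T -> #|U| <= N ->
       exists2 g' : {ffun I -> W}, g' \in T &
         forall i, if i == p then g' i \notin U else g' i == g i) ->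
  refreshable T set0 N.
Proof.
move=> step g Q U Tg _ leU.
suff [g' Tg' g'P] : exists2 g' : {ffun I -> W}, g' \in T &
    forall i, if i \in enum Q then g' i \notin U else g' i == g i.
  by exists g' => // i; have := g'P i; rewrite mem_enum.
elim: (enum Q) => [|p l [g1 Tg1 g1P]]; first by exists g => // i; apply: eqxx.
have [g2 Tg2 g2P] := step _ p _ Tg1 leU; exists g2 => // i.
rewrite inE; have := g2P i; case: (i == p) => //= /eqP->; exact: g1P.
Qed.

Section TreeEmbedding.

(** [Z E] is a supply of private vertices of [E], meant to receive the positions [Q0]; [U0] is kept
    free, for the image of a cross-cut. *)
Variables (V W I : finType) (s : seq {set V}) (Z : {set V} -> {set V}).
Variables (T : {set {ffun I -> W}}) (Q0 : {set I}) (U0 : {set W}).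

Let used i := \bigcup_(j < i) nth set0 s j.

Hypothesis card_s : forall i, i < size s -> #|nth set0 s i| = #|I|.
Hypothesis tree_s : forall i, 0 < i < size s ->
  exists2 a, a < i & nth set0 s i :&: used i \subset nth set0 s a.
Hypothesis subZ : forall i, i < size s -> Z (nth set0 s i) \subset nth set0 s i.
Hypothesis cardZ : forall i, i < size s -> #|Q0| <= #|Z (nth set0 s i)|.
Hypothesis privZ : forall i j, i < size s -> j < size s -> i != j ->
  [disjoint Z (nth set0 s i) & nth set0 s j].
Hypothesis injT : forall g : {ffun I -> W}, g \in T -> injective g.
Hypothesis refrT : refreshable T Q0 (#|V| + #|U0|).

Let placed (f : V -> W) (E : {set V}) := exists2 g : {ffun I -> W},
  g \in T & f @: E = [set g x | x : I] /\ g @: Q0 \subset f @: Z E.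

Let sub_used i j : j < i -> nth set0 s j \subset used i.
Proof. by move=> lt_ji; rewrite /used (bigcup_sup (Ordinal lt_ji)). Qed.

Let disjZ_used i : i < size s -> [disjoint Z (nth set0 s i) & used i].
Proof.
move=> lt_i; rewrite -setI_eq0 -subset0; apply/subsetP => v.
rewrite inE => /andP[Zv /bigcupP[j _ sjv]].
have lt_js := ltn_trans (ltn_ord j) lt_i.
by rewrite (disjointFr (privZ lt_i lt_js _) Zv) ?gtn_eqF in sjv.
Qed.

(* The fresh set [g' @: Q] receives the new vertices of the edge [E]; the
   images of [Q0] are assigned to private vertices so that they are never part
   of the intersection with a later edge. *)
Lemma tree_embedding_prefix (g0 : {ffun I -> W}) (w0 : W) i : g0 \in T ->
    i <= size s ->
  exists f : V -> W,
    [/\ {in used i &, injective f}, [disjoint f @: used i & U0] &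
        forall j, j < i -> placed f (nth set0 s j)].
Proof.
move=> Tg0; elim: i => [_|i IH lt_i].
  exists (fun=> w0); rewrite /used big_ord0; split=> //.
  - by move=> u v; rewrite inE.
  - by rewrite imset0 disjoints_subset sub0set.
have [f [injf avoidf plf]] := IH (ltnW lt_i).
set E := nth set0 s i; set K := E :&: used i.
(* The part [K] already placed lies in one earlier edge, whose labelling covers [f @: K]; the images
   of [Q0] there come from vertices private to that edge, so they miss [f @: K]. For the first edge
   [K] is empty and [g0] serves. *)
have [g Tg [fK gQ0]] : exists2 g : {ffun I -> W}, g \in T &
   f @: K \subset [set g x | x : I] /\ [disjoint g @: Q0 & f @: K].
  case: (posnP i) => [i0|i_gt0].
    exists g0 => //; have -> : K = set0 by rewrite /K i0 /used big_ord0 setI0.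
    by rewrite imset0 sub0set disjoint_sym disjoints_subset sub0set.
  have [|a lt_ai Ka] := @tree_s i; first by rewrite i_gt0.
  have [g Tg [gP gQ0]] := plf a lt_ai; exists g => //; split.
    by rewrite -gP imsetS.
  rewrite (disjointWl gQ0) // -setI_eq0 -subset0; apply/subsetP => w.
  rewrite inE => /andP[/imsetP[u Zu ->] /imsetP[v Kv fuv]].
  have lt_as := ltn_trans lt_ai lt_i.
  have ua : u \in used i.
    exact: (subsetP (sub_used lt_ai)) (subsetP (subZ lt_as) _ Zu).
  move: Kv; rewrite inE => /andP[Ev vu].
  have uv := injf _ _ ua vu fuv; move: Ev.
  by rewrite -uv (disjointFr (privZ lt_as lt_i _) Zu) // neq_ltn lt_ai.
have injfK : {in K &, injective f}.
  by move=> u v /setIP[_ uu] /setIP[_ uv]; apply: injf.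
pose Q := [set x | g x \notin f @: K].
have sQ : Q0 \subset Q.
  by apply/subsetP => x Qx; rewrite inE (disjointFr gQ0) ?imset_f.
have leU : #|f @: used i :|: U0| <= #|V| + #|U0|.
  rewrite (leq_trans (leq_card_setU _ _)) // leq_add2r.
  by rewrite (leq_trans (leq_imset_card _ _)) // max_card.
have [g' Tg' g'P] := refrT Tg sQ leU.
have injg' := injT Tg'.
have dY : [disjoint f @: used i :|: U0 & g' @: Q].
  rewrite disjoint_sym -setI_eq0 -subset0; apply/subsetP => w.
  rewrite inE => /andP[/imsetP[x Qx ->]]; have := g'P x; rewrite Qx.
  by move/negPf->.
have fKg' : f @: K \subset [set g' x | x : I].
  apply/subsetP => w fw; have /imsetP[x _ wx] := subsetP fK _ fw.
  have := g'P x; rewrite inE -wx fw /= => /eqP e.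
  by rewrite -e imset_f.
have cardQ : #|Q| = #|E :\: used i|.
  have cardK : #|~: Q| = #|K|.
    rewrite -(card_in_imset injfK) -(card_imset _ (injT Tg)).
    congr #|pred_of_set _|; apply/setP => w; apply/imsetP/idP => [[x]|fw].
      by rewrite !inE negbK => ? ->.
    have /imsetP[x _ wx] := subsetP fK _ fw; exists x => //.
    by rewrite !inE negbK -wx.
  apply/eqP; rewrite -(eqn_add2l #|K|) cardsID card_s // -cardK addnC.
  by rewrite cardsC.
(* Exactly [#|Q0|] private vertices are cut out, so that they fill [g' @: Q0]; the other new
   vertices of [E] go to the rest of [g' @: Q] in a second extension. *)
pose Z' := [set x in take #|Q0| (enum (Z E))].
have Z'E : Z' \subset Z E.
  by apply/subsetP => x; rewrite inE => /mem_take; rewrite mem_enum.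
have cardZ' : #|Z'| = #|Q0|.
  rewrite cardsE (card_uniqP _) ?take_uniq ?enum_uniq // size_take -cardE.
  by have := cardZ lt_i; rewrite leq_eqVlt => /orP[/eqP<-|->//]; rewrite ltnn.
have dZ' : [disjoint used i & Z'].
  by rewrite disjoint_sym (disjointWl Z'E) // disjZ_used.
have dY1 : [disjoint f @: used i & g' @: Q0].
  by rewrite (disjointW _ _ dY) ?subsetUl ?imsetS.
have [|f1 [f1used f1Z' injf1]] := extend_injection injf dZ' dY1.
  by rewrite card_imset // cardZ'.
have {}f1Z' : f1 @: Z' = g' @: Q0.
  apply/eqP; rewrite eqEcard f1Z' card_imset // -cardZ' card_in_imset ?leqnn //.
  by move=> u v Zu Zv; apply: injf1; rewrite inE ?Zu ?Zv orbT.
have f1used' : f1 @: used i = f @: used i by apply: eq_in_imset.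
have dX : [disjoint used i :|: Z' & E :\: used i :\: Z'].
  rewrite disjoint_sym disjoints_subset; apply/subsetP => x.
  by rewrite !inE => /andP[/negPf-> /andP[/negPf->]].
have dY2 : [disjoint f1 @: (used i :|: Z') & g' @: (Q :\: Q0)].
  rewrite disjoint_sym -setI_eq0 -subset0; apply/subsetP => w.
  rewrite inE => /andP[/imsetP[x /setDP[Qx nQx] ->]].
  rewrite imsetU f1used' f1Z' inE mem_imset // (negPf nQx) orbF.
  have /negbT := disjointFl dY (imset_f g' Qx).
  by rewrite inE => /norP[/negPf->].
have [|f2 [f2used f2X injf2]] := extend_injection injf1 dX dY2.
  rewrite card_imset //.
  have := cardsID Q0 Q; have := cardsID Z' (E :\: used i).
  have /setIidPr-> : Z' \subset E :\: used i.
    rewrite subsetD disjoint_sym dZ' andbT.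
    exact: subset_trans Z'E (subZ lt_i).
  by rewrite (setIidPr sQ) cardQ cardZ' => <- /eqP; rewrite eqn_add2l => /eqP->.
have usedS : used i.+1 = used i :|: E by rewrite /used big_ord_recr.
have usedS' : used i.+1 = used i :|: Z' :|: (E :\: used i :\: Z').
  rewrite usedS; apply/setP => x; rewrite !inE.
  case: (x \in used i) => //=; case Zx: (x \in take _ _) => //=.
  apply: (subsetP (subZ lt_i)); apply: (subsetP Z'E); by rewrite inE.
have f2f : {in used i, f2 =1 f}.
  by move=> x ux; rewrite f2used ?f1used // inE ux.
have f2Z' : f2 @: Z' = g' @: Q0.
  rewrite -f1Z'; apply: eq_in_imset => x Zx.
  by rewrite f2used // inE Zx orbT.
have f2new x : x \in used i.+1 -> x \notin used i -> f2 x \in g' @: Q.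
  rewrite usedS' !inE -orbA => /or3P[->//|Zx _|Xx _].
    have : f2 x \in g' @: Q0 by rewrite -f2Z' imset_f // inE.
    by apply/subsetP/imsetS.
  have : f2 x \in g' @: (Q :\: Q0).
    by apply: (subsetP f2X); apply: imset_f; rewrite !inE.
  by apply/subsetP/imsetS/subsetDl.
have sE : E \subset used i.+1 by rewrite usedS subsetUr.
have injf2' : {in used i.+1 &, injective f2} by rewrite usedS'.
exists f2; split=> // [|j].
  rewrite -setI_eq0 -subset0; apply/subsetP => w; rewrite inE.
  move=> /andP[/imsetP[x ux ->]]; case: (boolP (x \in used i)) => uix.
    by rewrite f2f // (disjointFr avoidf) ?imset_f.
  have /negbT := disjointFl dY (f2new _ ux uix).
  by rewrite inE => /norP[_ /negPf->].
rewrite ltnS leq_eqVlt => /orP[/eqP->|lt_ji]; last first.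
  have [gj Tgj [gjP gjQ0]] := plf j lt_ji; exists gj => //.
  have sj := sub_used lt_ji.
  have imf2 (B : {set V}) : B \subset nth set0 s j -> f2 @: B = f @: B.
    move=> sB; apply: eq_in_imset => x Bx; apply: f2f.
    by apply: (subsetP sj); apply: (subsetP sB).
  by rewrite !imf2 // subZ // (ltn_trans lt_ji).
exists g' => //; split; last by rewrite -f2Z' imsetS.
apply/eqP; rewrite eqEcard (_ : #|[set g' x | x : I]| = #|E|); last first.
  by rewrite card_imset // card_s.
rewrite card_in_imset ?leqnn ?andbT; last first.
  by move=> x y Ex Ey; apply: injf2'; apply: (subsetP sE).
apply/subsetP => w /imsetP[x Ex ->].
case: (boolP (x \in used i)) => uix.
  rewrite f2f //; apply: (subsetP fKg'); apply: imset_f.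
  by rewrite inE Ex.
have /imsetP[y _ ->] := f2new _ (subsetP sE _ Ex) uix; exact: imset_f.
Qed.

Lemma tree_embedding (g0 : {ffun I -> W}) (w0 : W) : g0 \in T ->
  exists f : V -> W,
    [/\ {in used (size s) &, injective f},
        [disjoint f @: used (size s) & U0] &
        forall j, j < size s -> exists2 g : {ffun I -> W}, g \in T &
          f @: nth set0 s j = [set g x | x : I]].
Proof.
move=> Tg0; have [f [injf df plf]] := tree_embedding_prefix w0 Tg0 (leqnn _).
by exists f; split=> // j /plf[g Tg [gP _]]; exists g.
Qed.

End TreeEmbedding.

(** * Deletion of low degrees *)

(** The incidence [inc] is abstract because it is applied to facets of edges and to ordered sets
    with one position omitted, with or without a colour. *)
Definition shadow (X Y : finType) (inc : X -> {set Y}) (A : {set X}) :=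
  \bigcup_(x in A) inc x.

Definition star (X Y : finType) (inc : X -> {set Y}) (A : {set X}) (y : Y) :=
  [set x in A | y \in inc x].

Lemma shadowS (X Y : finType) (inc : X -> {set Y}) (A B : {set X}) :
  A \subset B -> shadow inc A \subset shadow inc B.
Proof.
move=> sAB; apply/bigcupsP => x Ax.
by rewrite (bigcup_sup x) // (subsetP sAB).
Qed.

Lemma card_shadow_remove_star (X Y : finType) (inc : X -> {set Y})
    (A : {set X}) y : y \in shadow inc A ->
  #|shadow inc (A :\: star inc A y)| < #|shadow inc A|.
Proof.
move=> Ay; apply/proper_card/properP; split.
  by apply/shadowS/subsetDl.
exists y => //; apply/bigcupP => -[x]; rewrite !inE negb_and.
by case/andP=> /orP[/negPf->|/negPf->].
Qed.

Lemma card_remove_star (X Y : finType) (inc : X -> {set Y}) (A : {set X}) y :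
  #|A| = #|star inc A y| + #|A :\: star inc A y|.
Proof.
rewrite -(cardsID (star inc A y) A) (setIidPr _) //.
by apply/subsetP => x; rewrite inE => /andP[].
Qed.

(** Deleting the star of a [y] of degree at most [k] costs at most [k] elements and removes [y] from
    the shadow, so [#|A| - k * #|shadow inc A|] never decreases. *)
Lemma remove_low_degree (X Y : finType) (inc : X -> {set Y}) k (A : {set X}) :
  exists2 A' : {set X}, A' \subset A &
    #|A| + k * #|shadow inc A'| <= #|A'| + k * #|shadow inc A| /\
    forall y, y \in shadow inc A' -> k < #|star inc A' y|.
Proof.
have [n] := ubnP #|A|; elim: n => // n IH in A *; rewrite ltnS => leAn.
case: (boolP [forall y in shadow inc A, k < #|star inc A y|]) => [/forall_inP|].
  by move=> degA; exists A => //; split.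
rewrite negb_forall_in => /exists_inP[y Ay]; rewrite -leqNgt => ley.
have ltS := card_shadow_remove_star Ay; have eqA := card_remove_star inc A y.
have star_gt0 : 0 < #|star inc A y|.
  case/bigcupP: Ay => x Ax yx; apply/card_gt0P; exists x.
  by rewrite inE Ax.
have [|A' sA' [leA' degA']] := IH (A :\: star inc A y).
  by rewrite (leq_trans _ leAn) // eqA -[ltnLHS]add0n ltn_add2r.
exists A'; first exact: subset_trans sA' (subsetDl _ _).
split=> //; rewrite eqA -addnA (leq_trans (leq_add ley leA')) //.
by rewrite addnCA leq_add2l -mulnS leq_mul2l ltS orbT.
Qed.

(** In use, [b] omits one position and [c] is one extension vertex. Large degrees let any position
    be refreshed; many values of [c] on a class let the extension vertex move as well. *)
Definition spread (X Y B W : finType) (inc : X -> {set Y}) (b : X -> B)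
    (c : X -> W) (k q : nat) (A : {set X}) : Prop :=
  [/\ A != set0,
      forall y, y \in shadow inc A -> k < #|star inc A y| &
      forall x, x \in A -> q < #|c @: [set x' in A | b x' == b x]|].

(* A deleted [x] with few values of [c] on its [b]-class is put back at the end:
   its class then only contains elements that were present when [x] left. *)
Lemma spread_dichotomy (X Y B W : finType) (inc : X -> {set Y}) (b : X -> B)
    (c : X -> W) k q (A : {set X}) :
  exists2 A' : {set X}, A' \subset A &
    spread inc b c k q A' \/
    #|A| <= #|A'| + k * #|shadow inc A| /\
    forall x, x \in A' -> #|c @: [set x' in A' | b x' == b x]| <= q.
Proof.
have [n] := ubnP #|A|; elim: n => // n IH in A *; rewrite ltnS => leAn.
have [->|A_neq0] := eqVneq A set0.
  by exists set0 => //; right; split=> [|x]; rewrite ?cards0 ?inE.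
case: (boolP [forall y in shadow inc A, k < #|star inc A y|]); last first.
  rewrite negb_forall_in => /exists_inP[y Ay]; rewrite -leqNgt => ley.
  have ltS := card_shadow_remove_star Ay; have eqA := card_remove_star inc A y.
  have star_gt0 : 0 < #|star inc A y|.
    case/bigcupP: Ay => x Ax yx; apply/card_gt0P; exists x.
    by rewrite inE Ax.
  have [|A' sA' spA'] := IH (A :\: star inc A y).
    by rewrite (leq_trans _ leAn) // eqA -[ltnLHS]add0n ltn_add2r.
  exists A'; first exact: subset_trans sA' (subsetDl _ _).
  case: spA' => [?|[leA' degA']]; [by left | right; split=> //].
  rewrite eqA (leq_trans (leq_add ley leA')) //.
  by rewrite addnCA leq_add2l -mulnS leq_mul2l ltS orbT.
move/forall_inP => degA.
case: (boolP [forall x in A, q < #|c @: [set x' in A | b x' == b x]|]).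
  by move/forall_inP => spA; exists A => //; left; split.
rewrite negb_forall_in => /exists_inP[x Ax]; rewrite -leqNgt => lex.
have eqA := cardsD1 x A; rewrite Ax in eqA.
have [|A' sA' spA'] := IH (A :\ x); first by rewrite -add1n -eqA.
have sA'A : A' \subset A by rewrite (subset_trans sA') ?subD1set.
have nA'x : x \notin A'.
  by apply/negP => /(subsetP sA'); rewrite !inE eqxx.
case: spA' => [?|[leA' degA']]; first by exists A' => //; left.
exists (x |: A'); first by rewrite subUset sub1set Ax.
right; split=> [|z].
  rewrite cardsU1 nA'x eqA -addnA leq_add2l (leq_trans leA') //.
  by rewrite leq_add2l leq_mul2l subset_leq_card ?orbT ?shadowS ?subD1set.
have [bzx _|bzx] := eqVneq (b z) (b x).
  rewrite (leq_trans _ lex) // subset_leq_card // imsetS //.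
  apply/subsetP => u; rewrite !inE bzx => /andP[/orP[/eqP->|/(subsetP sA'A)->]].
    by rewrite Ax eqxx.
  by [].
rewrite !inE => /orP[/eqP zx|A'z]; first by rewrite zx eqxx in bzx.
rewrite (leq_trans _ (degA' z A'z)) // subset_leq_card // imsetS //.
apply/subsetP => u; rewrite !inE => /andP[/orP[/eqP->|->]] //.
by rewrite eq_sym (negPf bzx).
Qed.

(** The indices in [l] are treated in turn. Few values on a class stay few in a subfamily, so only
    the deletion costs add up. *)
Lemma spread_dichotomy_seq (J X Y B W : finType) (inc : X -> {set Y})
    (b : J -> X -> B) (c : J -> X -> W) k q (l : seq J) (A : {set X}) :
  exists2 A' : {set X}, A' \subset A &
    (exists j, spread inc (b j) (c j) k q A') \/
    #|A| <= #|A'| + size l * (k * #|shadow inc A|) /\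
    forall j x, j \in l -> x \in A' ->
      #|c j @: [set x' in A' | b j x' == b j x]| <= q.
Proof.
elim: l A => [|j l IH] A; first by exists A => //; right; rewrite addn0; split.
have [A1 sA1 [sp|[le1 deg1]]] := spread_dichotomy inc (b j) (c j) k q A.
  by exists A1 => //; left; exists j.
have [A2 sA2 [sp|[le2 deg2]]] := IH A1.
  by exists A2; [apply: subset_trans sA1 | left].
exists A2; first exact: subset_trans sA1.
right; split=> [|i x].
  rewrite (leq_trans le1) //= mulSn [k * _ + _]addnC addnA leq_add2r.
  rewrite (leq_trans le2) // leq_add2l !leq_mul2l subset_leq_card ?orbT //.
  exact: shadowS.
rewrite inE => /orP[/eqP->|li] A2x; last exact: deg2.
rewrite (leq_trans _ (deg1 x (subsetP sA2 _ A2x))) // subset_leq_card //.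
apply/imsetS/subsetP => u; rewrite !inE => /andP[A2u ->].
by rewrite (subsetP sA2).
Qed.

(** * Three situations forcing a copy of the tree *)

Lemma exists_injective_ffun (I W : finType) (Y : {set W}) (w0 : W) :
  #|I| <= #|Y| ->
  exists2 g : {ffun I -> W}, injective g & [set g x | x : I] \subset Y.
Proof.
rewrite -cardsT => leIY.
have inj0 : {in (set0 : {set I}) &, injective (fun=> w0)}.
  by move=> x y; rewrite inE.
have d1 : [disjoint (set0 : {set I}) & [set: I]].
  by rewrite disjoints_subset sub0set.
have d2 : [disjoint (fun=> w0) @: (set0 : {set I}) & Y].
  by rewrite imset0 disjoints_subset sub0set.
have [f [_ fY injf]] := extend_injection inj0 d1 d2 leIY.
exists [ffun x => f x].
  by move=> x y; rewrite !ffunE; apply: injf; rewrite !inE.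
apply/subsetP => w /imsetP[x _ ->]; rewrite ffunE.
by apply: (subsetP fY); apply: imset_f.
Qed.

Definition facets (W : finType) m (E : {set W}) :=
  [set D : {set W} | (D \subset E) && (#|D| == m)].

Lemma card_star_facets (W : finType) m (F : {set {set W}}) (D : {set W}) :
    uniform m.+1 F -> #|D| = m ->
  #|star (facets m) F D| <= #|[set x | (x \notin D) && (x |: D \in F)]|.
Proof.
move=> unifF cardD.
rewrite -(card_in_imset (f := fun E => E :\: D)); last first.
  move=> E1 E2; rewrite !inE => /and3P[_ sD1 _] /and3P[_ sD2 _] e.
  by rewrite -(setID E1 D) -(setID E2 D) e (setIidPr sD1) (setIidPr sD2).
rewrite -(card_imset (mem [set x | (x \notin D) && (x |: D \in F)]) set1_inj).
apply/subset_leq_card/subsetP => _ /imsetP[E + ->].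
rewrite !inE => /and3P[FE sDE _].
have /cards1P[x Ex] : #|E :\: D| == 1.
  by rewrite cardsD (setIidPr sDE) cardD (eqP (forall_inP unifF E FE)) subSnn.
rewrite Ex; apply: imset_f; rewrite inE.
have : x \in E :\: D by rewrite Ex set11.
rewrite inE => /andP[-> _] /=.
by move: FE; rewrite -{1}(setID E D) (setIidPr sDE) Ex setUC.
Qed.

(** [contains] asks for a map injective on all of [V], so the vertices outside [A] must be placed
    too; [#|V| <= #|W|] leaves room for them. *)
Lemma contains_of_partial (V W : finType) (H : {set {set V}})
    (F : {set {set W}}) (A : {set V}) (f : V -> W) :
    #|V| <= #|W| -> {in A &, injective f} ->
    (forall E, E \in H -> E \subset A) ->
    (forall E, E \in H -> f @: E \in F) ->
  contains F H.
Proof.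
move=> leVW injf sHA fH.
have dA : [disjoint A & ~: A] by rewrite disjoints_subset setCK.
have dY : [disjoint f @: A & ~: (f @: A)] by rewrite disjoints_subset setCK.
have [|f' [f'f _ injf']] := extend_injection injf dA dY.
  rewrite -(leq_add2l #|A|) cardsC -(card_in_imset injf) cardsC.
  exact: leVW.
rewrite setUCr in injf'.
apply/existsP; exists [ffun x => f' x]; apply/andP; split.
  by apply/injectiveP => x y; rewrite !ffunE; apply: injf'; rewrite inE.
apply/forall_inP => E HE; rewrite (_ : _ @: E = f @: E) ?fH //.
apply: eq_in_imset => x Ex; rewrite ffunE; apply: f'f.
exact: subsetP (sHA E HE) _ Ex.
Qed.

(** * Ordered sets with one position omitted *)

Definition omit (m : nat) (W : finType) (p : 'I_m.+1)
    (d : {ffun 'I_m.+1 -> W}) :=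
  [ffun i : 'I_m => d (lift p i)].

Lemma omit_eq (m : nat) (W : finType) p (d d' : {ffun 'I_m.+1 -> W}) i :
  omit p d = omit p d' -> i != p -> d i = d' i.
Proof.
move=> e; case: (unliftP p i) => [j ->|->]; last by rewrite eqxx.
by have := congr1 (fun h : {ffun 'I_m -> W} => h j) e; rewrite !ffunE.
Qed.

Lemma omit_inj (m : nat) (W : finType) p (d d' : {ffun 'I_m.+1 -> W}) :
  omit p d = omit p d' -> d p = d' p -> d = d'.
Proof.
move=> e ep; apply/ffunP => i.
by have [->//|ip] := eqVneq i p; apply: omit_eq e ip.
Qed.

(** With the other positions fixed to [B], a member of [S] is determined by its value at [p], so [U]
    cannot hold the values of all members. *)
Lemma exists_fresh (m : nat) (W : finType) p B (S : {set {ffun 'I_m.+1 -> W}})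
    (U : {set W}) :
    (forall d, d \in S -> omit p d = B) -> #|U| < #|S| ->
  exists2 d : {ffun 'I_m.+1 -> W}, d \in S & d p \notin U.
Proof.
move=> SB ltU; apply/exists_inP; apply: contraLR ltU.
rewrite negb_exists_in => /forall_inP SU; rewrite -leqNgt.
rewrite -(card_in_imset (f := fun d : {ffun 'I_m.+1 -> W} => d p)).
  by apply/subset_leq_card/subsetP => w /imsetP[d /SU]; rewrite negbK => ? ->.
by move=> d d' Sd Sd'; apply: (@omit_inj _ _ p); rewrite (SB d) ?(SB d').
Qed.

Definition omissions (m : nat) (W : finType) (d : {ffun 'I_m.+1 -> W}) :=
  [set (p, omit p d) | p : 'I_m.+1].

Lemma in_omissions (m : nat) (W : finType) (d : {ffun 'I_m.+1 -> W}) p B :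
  ((p, B) \in omissions d) = (omit p d == B).
Proof.
by apply/imsetP/eqP => [[p' _ [-> ->]]|<-] //; exists p.
Qed.

(** The colour [c d] is recorded so that a star contains sets of one colour only: refreshing inside
    it preserves all extension vertices. *)
Definition colored_omissions (m : nat) (W C : finType)
    (c : {ffun 'I_m.+1 -> W} -> C) (d : {ffun 'I_m.+1 -> W}) :=
  [set (p, omit p d, c d) | p : 'I_m.+1].

Lemma in_colored_omissions (m : nat) (W C : finType)
    (c : {ffun 'I_m.+1 -> W} -> C) (d : {ffun 'I_m.+1 -> W}) p B x :
  ((p, B, x) \in colored_omissions c d) = (omit p d == B) && (c d == x).
Proof.
apply/imsetP/andP => [[p' _ [-> -> ->]]|[/eqP<- /eqP<-]]; last by exists p.
by rewrite !eqxx.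
Qed.

Lemma degree1_edge_eq (V : finType) (H : {set {set V}}) v E E' :
  degree H v == 1 -> E \in H -> E' \in H -> v \in E -> v \in E' -> E = E'.
Proof.
case/cards1P=> E0 e HE HE' vE vE'.
have : E \in [set E in H | v \in E] by rewrite inE HE.
have : E' \in [set E in H | v \in E] by rewrite inE HE'.
by rewrite e => /set1P-> /set1P->.
Qed.

Section Embeddings.

Variables (V W : finType) (m : nat) (H : {set {set V}}) (s : seq {set V}).
Variable F : {set {set W}}.
Hypothesis sH : s =i H.
Hypothesis uniq_s : uniq s.
Hypothesis unifH : uniform m.+2 H.
Hypothesis tree_s : forall i : nat, 0 < i < size s ->
  exists2 a : nat, a < i &
    nth set0 s i :&: \bigcup_(j < i) nth set0 s j \subset nth set0 s a.
Hypothesis leVW : #|V| <= #|W|.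

Let used := \bigcup_(j < size s) nth set0 s j.

Let nthH i : i < size s -> nth set0 s i \in H.
Proof. by move=> lt_i; rewrite -sH mem_nth. Qed.

Let subH E : E \in H -> E \subset used.
Proof.
rewrite -sH => sE; have lt_E : index E s < size s by rewrite index_mem.
by rewrite -(nth_index set0 sE) (bigcup_sup (Ordinal lt_E)).
Qed.

Let cardH i : i < size s -> #|nth set0 s i| = m.+2.
Proof. by move/nthH/(forall_inP unifH)/eqP. Qed.

(** The labelled edges are all orderings of edges of [F]. Each facet has more than [#|V|]
    extensions, so the vertex at any position can be exchanged for a fresh one, and the greedy
    embedding runs with [Q0] empty. *)
Lemma contains_of_large_degrees :
    uniform m.+2 F -> F != set0 ->
    (forall D, D \in shadow (facets m.+1) F ->
       #|V| < #|star (facets m.+1) F D|) ->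
  contains F H.
Proof.
move=> unifF /set0Pn[E0 FE0] degF.
pose T : {set {ffun 'I_m.+2 -> W}} :=
  [set g : {ffun 'I_m.+2 -> W} |
     injectiveb g && ([set g x | x : 'I_m.+2] \in F)].
have cardE0 : #|E0| = m.+2 by apply/eqP/(forall_inP unifF).
have /card_gt0P[w0 _] : 0 < #|E0| by rewrite cardE0.
have [|g0 injg0 g0E] := @exists_injective_ffun 'I_m.+2 W E0 w0.
  by rewrite cardE0 card_ord.
have Tg0 : g0 \in T.
  rewrite inE; apply/andP; split; first exact/injectiveP.
  suff -> : [set g0 x | x : 'I_m.+2] = E0 by [].
  by apply/eqP; rewrite eqEcard g0E card_imset // card_ord cardE0 /=.
have refr : refreshable T set0 (#|V| + #|(set0 : {set W})|).
  apply: refreshable_pointwise => g p U; rewrite inE cards0 addn0.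
  move=> /andP[/injectiveP injg Fg] leU.
  pose D := g @: [set~ p].
  have cardD : #|D| = m.+1 by rewrite card_imset // cardsC1 card_ord.
  have D_shadow : D \in shadow (facets m.+1) F.
    apply/bigcupP; exists [set g x | x : 'I_m.+2] => //.
    rewrite inE cardD eqxx andbT; apply/subsetP => w /imsetP[i _ ->].
    exact: imset_f.
  have := leq_trans (degF D D_shadow) (card_star_facets unifF cardD).
  move/(leq_ltn_trans leU) => ltU.
  have /subsetPn[x] : ~~ ([set x | (x \notin D) && (x |: D \in F)] \subset U).
    by apply: contraL ltU => /subset_leq_card; rewrite -leqNgt.
  rewrite inE => /andP[Dx Fx] Ux.
  exists [ffun i => if i == p then x else g i]; last first.
    by move=> i; rewrite ffunE; case: (i == p).
  rewrite inE; apply/andP; split.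
    apply/injectiveP => i j; rewrite !ffunE.
    have notD k : k != p -> g k != x.
      move=> kp; apply: contraNneq Dx => <-; apply: imset_f.
      by rewrite !inE.
    have [->|ip] := eqVneq i p; have [->|jp] := eqVneq j p => //.
    - by move/esym/eqP; rewrite (negPf (notD j jp)).
    - by move/eqP; rewrite (negPf (notD i ip)).
    exact: injg.
  rewrite (_ : [set _ | _ in _] = x |: D) //; apply/setP => w.
  apply/imsetP/setU1P => [[i _ ->]|[->|/imsetP[i ip ->]]].
  - rewrite ffunE; have [_|ip] := eqVneq i p; [by left | right].
    by apply: imset_f; rewrite !inE.
  - by exists p; rewrite // ffunE eqxx.
  - by exists i; rewrite // ffunE; rewrite !inE in ip; rewrite (negPf ip).
have [] := @tree_embedding V W _ s (fun=> set0) T set0 set0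
             _ tree_s _ _ _ _ refr g0 w0 Tg0.
- by move=> i /cardH->; rewrite card_ord.
- by move=> *; apply: sub0set.
- by move=> *; rewrite !cards0.
- by move=> *; rewrite disjoints_subset sub0set.
- by move=> g; rewrite inE => /andP[/injectiveP].
move=> f [injf _ fs]; apply: (contains_of_partial leVW injf subH) => E.
rewrite -sH => sE; have lt_E : index E s < size s by rewrite index_mem.
have [g Tg] := fs _ lt_E; rewrite nth_index // => ->.
by move: Tg; rewrite inE => /andP[].
Qed.

Variables (k : nat) (A : {set {ffun 'I_m.+1 -> W}}).
Variable c : {ffun 'I_m.+1 -> W} -> {ffun 'I_k -> W}.
Hypothesis injA : forall d, d \in A -> injective d.
Hypothesis cA : forall d, d \in A -> injective (c d).
Hypothesis nImA : forall d j, d \in A ->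
  c d j \notin [set d i | i : 'I_m.+1].
Hypothesis FA : forall d j, d \in A ->
  c d j |: [set d i | i : 'I_m.+1] \in F.

(** The label [None] carries [c d j] and [Some i] carries [d i]. Since [c d j] may change whenever
    [d] moves, [None] and [Some p] are put on two vertices of degree 1, which 2-reducibility
    provides in every edge and which no other edge contains. *)
Lemma contains_of_spread p j q : two_reducible H -> 2 * #|V| <= q ->
    spread (@omissions m W) (omit p) (fun d => c d j) #|V| q A ->
  contains F H.
Proof.
move=> redH leq2 [A_neq0 degA spA].
have refrA : refreshable A set0 #|V|.
  apply: refreshable_pointwise => d i U Ad leU.
  have Ai : (i, omit i d) \in shadow (@omissions m W) A.
    by apply/bigcupP; exists d; rewrite // in_omissions.
  have := leq_ltn_trans leU (degA _ Ai).
  case/(exists_fresh (p := i) (B := omit i d)).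
    by move=> d'; rewrite inE in_omissions => /andP[_ /eqP].
  move=> d'; rewrite inE in_omissions => /andP[Ad' /eqP e] Ud'.
  exists d' => // i'; have [->//|i'i] := eqVneq i' i.
  by rewrite (omit_eq e i'i).
pose mk (d : {ffun 'I_m.+1 -> W}) :=
  [ffun o : option 'I_m.+1 => oapp d (c d j) o].
pose Q0 : {set option 'I_m.+1} := [set None; Some p].
pose Z (E : {set V}) := [set v in E | degree H v == 1].
have refr : refreshable (mk @: A) Q0 (#|V| + #|(set0 : {set W})|).
  rewrite cards0 addn0 => _ Q U /imsetP[d Ad ->] sQ leU.
  (* First the positions of [Q] are moved; [p] and the extension vertex are then settled together
     within one class of [omit p]. *)
  have [d1 Ad1 d1P] := refrA d [set i | Some i \in Q] U Ad (sub0set _) leU.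
  pose S := [set d' in A | omit p d' == omit p d1].
  have [d2 [Sd2 Ud2 Uc2]] : exists d2 : {ffun 'I_m.+1 -> W},
      [/\ d2 \in S, d2 p \notin U & c d2 j \notin U].
    (* At most [#|U|] members of the class have their value at [p] in [U]. Their values of [c] and
       [U] itself rule out at most [2 * #|V| <= q] values, and the class has more than [q]. *)
    pose S' := [set d' in S | d' p \in U].
    have leS' : #|S'| <= #|U|.
      rewrite leqNgt; apply/negP => /(exists_fresh (p := p) (B := omit p d1)).
      case=> [d'|d']; first by rewrite !inE => /andP[/andP[_ /eqP]].
      by rewrite inE => /andP[_ ->].
    have : ~~ ((fun d' => c d' j) @: S \subset (fun d' => c d' j) @: S' :|: U).
      apply: contraL (spA d1 Ad1) => /subset_leq_card le1; rewrite -leqNgt.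
      rewrite (leq_trans le1) // (leq_trans (leq_card_setU _ _)) //.
      rewrite (leq_trans _ leq2) // mul2n -addnn leq_add //.
      by rewrite (leq_trans (leq_imset_card _ _)) // (leq_trans leS').
    case/subsetPn => _ /imsetP[d2 Sd2 ->]; rewrite inE => /norP[nS' Uc2].
    exists d2; split=> //; apply: contra nS' => Ud2.
    by apply: (imset_f (fun d' => c d' j)); rewrite inE Sd2.
  move: Sd2; rewrite inE => /andP[Ad2 /eqP e2].
  exists (mk d2); first exact: imset_f.
  case=> [i|]; rewrite !ffunE /=; last first.
    by rewrite (subsetP sQ) // !inE eqxx.
  have [->|ip] := eqVneq i p.
    by rewrite (subsetP sQ) // !inE eqxx orbT.
  by rewrite (omit_eq e2 ip); have := d1P i; rewrite inE.
have /set0Pn[d0 Ad0] := A_neq0.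
have [] := @tree_embedding V W _ s Z (mk @: A) Q0 set0
             _ tree_s _ _ _ _ refr (mk d0) (d0 ord0).
- by move=> i /cardH->; rewrite card_option card_ord.
- by move=> i _; apply/subsetP => v; rewrite inE => /andP[].
- move=> i lt_i; rewrite cards2 /=; exact: (forall_inP redH) _ (nthH lt_i).
- move=> i i' lt_i lt_i' ii'; rewrite -setI_eq0 -subset0; apply/subsetP => v.
  rewrite !inE => /andP[/andP[iv deg1v] i'v].
  have := nth_uniq set0 lt_i lt_i' uniq_s; rewrite (negPf ii') => /negbT/eqP[].
  exact: degree1_edge_eq deg1v (nthH lt_i) (nthH lt_i') iv i'v.
- move=> _ /imsetP[d Ad ->] [x|] [y|]; rewrite !ffunE //=.
  + by move/(injA Ad)->.
  + by move=> e; have := nImA j Ad; rewrite -e imset_f.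
  + by move=> e; have := nImA j Ad; rewrite e imset_f.
- exact: imset_f.
move=> f [injf _ fs]; apply: (contains_of_partial leVW injf subH) => E.
rewrite -sH => sE; have lt_E : index E s < size s by rewrite index_mem.
have [_ /imsetP[d Ad ->]] := fs _ lt_E; rewrite nth_index // => ->.
rewrite (_ : [set _ | _ in _] = c d j |: [set d i | i : 'I_m.+1]) ?FA //.
apply/setP => w; apply/imsetP/setU1P => [[[i|] _ ->]|[->|/imsetP[i ip ->]]].
- by right; rewrite ffunE; apply: imset_f.
- by left; rewrite ffunE.
- by exists None; rewrite // ffunE.
- by exists (Some i); rewrite // ffunE.
Qed.

(** Within one colour every position can be refreshed. The traces [E :\: S] have [m.+1] vertices and
    inherit the tree order; they are embedded as sets of this colour off [U0], and [S] is sent into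
    [U0]. *)
Lemma contains_of_colored_degrees (S : {set V}) : crosscut H S -> #|S| = k ->
    A != set0 ->
    (forall y, y \in shadow (colored_omissions c) A ->
       #|V| + k < #|star (colored_omissions c) A y|) ->
  contains F H.
Proof.
move=> crossS cardS /set0Pn[d0 Ad0] degA.
pose c0 := c d0; pose U0 := [set c0 j | j : 'I_k].
have cardU0 : #|U0| = k by rewrite card_imset ?card_ord //; apply: cA.
pose T := [set d in A | c d == c0].
have refr : refreshable T set0 (#|V| + #|U0|).
  rewrite cardU0; apply: refreshable_pointwise => d i U.
  rewrite inE => /andP[Ad /eqP cd] leU.
  have Ai : (i, omit i d, c0) \in shadow (colored_omissions c) A.
    by apply/bigcupP; exists d; rewrite // in_colored_omissions cd !eqxx.
  have := leq_ltn_trans leU (degA _ Ai).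
  case/(exists_fresh (p := i) (B := omit i d)).
    by move=> d'; rewrite inE in_colored_omissions => /and3P[_ /eqP].
  move=> d'; rewrite inE in_colored_omissions => /and3P[Ad' /eqP e cd'] Ud'.
  exists d'; first by rewrite inE Ad'.
  by move=> i'; have [->//|i'i] := eqVneq i' i; rewrite (omit_eq e i'i).
pose s' := [seq E :\: S | E <- s].
have nth_s' i : nth set0 s' i = nth set0 s i :\: S.
  have [lt_i|le_i] := ltnP i (size s); first by rewrite (nth_map set0).
  by rewrite !nth_default ?set0D // size_map.
have size_s' : size s' = size s by rewrite size_map.
have [] := @tree_embedding V W 'I_m.+1 s' (fun=> set0) T set0 U0
             _ _ _ _ _ _ refr d0 (d0 ord0).
- move=> i; rewrite size_s' nth_s' => lt_i; rewrite card_ord cardsD setIC.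
  by rewrite cardH // (eqP (forall_inP crossS _ (nthH lt_i))) subn1.
- move=> i; rewrite size_s' => /tree_s[a lt_ai sub_a]; exists a => //.
  rewrite !nth_s'; apply/subsetP => v; rewrite !inE.
  case/andP=> /andP[-> iv] /bigcupP[i' _]; rewrite nth_s' inE => /andP[_ i'v].
  by apply: (subsetP sub_a); rewrite inE iv; apply/bigcupP; exists i'.
- by move=> *; apply: sub0set.
- by move=> *; rewrite !cards0.
- by move=> *; rewrite disjoints_subset sub0set.
- by move=> d; rewrite inE => /andP[/injA].
- by rewrite inE Ad0 eqxx.
rewrite size_s'; set used' := \bigcup_(i < _) _ => f [injf df fs].
have dS : [disjoint used' & S].
  rewrite -setI_eq0 -subset0; apply/subsetP => v.
  rewrite !inE => /andP[/bigcupP[i _]].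
  by rewrite nth_s' inE => /andP[/negPf->].
have [|f' [f'f f'S injf']] := extend_injection injf dS df.
  by rewrite cardS cardU0.
apply: (contains_of_partial leVW injf') => E; rewrite -sH => sE.
  apply/subsetP => v Ev; rewrite inE; case: (boolP (v \in S)) => Sv.
    by rewrite orbT.
  rewrite orbF; have lt_E : index E s < size s by rewrite index_mem.
  apply/bigcupP; exists (Ordinal lt_E) => //.
  by rewrite nth_s' /= nth_index // inE Sv.
have lt_E : index E s < size s by rewrite index_mem.
have [d] := fs _ lt_E; rewrite nth_s' nth_index // inE => /andP[Ad /eqP cd] fE.
have sE' : E :\: S \subset used'.
  apply/subsetP => v Ev; apply/bigcupP; exists (Ordinal lt_E) => //.
  by rewrite nth_s' /= nth_index.
have f'E : f' @: (E :\: S) = f @: (E :\: S).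
  by apply: eq_in_imset => v Ev; apply: f'f; apply: (subsetP sE').
have HE : E \in H by rewrite -sH.
(* The single vertex of [E] in [S] goes to some [c0 j]. As [c d] equals [c0], every [j] gives an
   edge of [F], whatever the order in which [S] fills [U0]. *)
have /cards1P[v Sv] := forall_inP crossS E HE.
have /imsetP[j _ fv] : f' v \in U0.
  apply: (subsetP f'S); apply: imset_f.
  by have : v \in S :&: E by [rewrite Sv set11]; rewrite inE => /andP[].
rewrite -(setID E S) imsetU f'E fE setIC Sv imset_set1 fv -cd.
exact: FA.
Qed.

End Embeddings.

(** * Counting *)

Lemma uniformS (W : finType) m (F F' : {set {set W}}) :
  F' \subset F -> uniform m F -> uniform m F'.
Proof.
move=> /subsetP sF unifF; apply/forall_inP => E /sF; exact: (forall_inP unifF).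
Qed.

Lemma containsS (V W : finType) (F F' : {set {set W}}) (H : {set {set V}}) :
  F' \subset F -> contains F' H -> contains F H.
Proof.
move=> /subsetP sF /existsP[f /andP[injf fH]]; apply/existsP; exists f.
by rewrite injf; apply/forall_inP => E HE; apply/sF/(forall_inP fH).
Qed.

Lemma exists_crosscut (V : finType) (H : {set {set V}}) :
  two_reducible H -> exists S, crosscut H S.
Proof.
move=> redH; pose priv (E : {set V}) := [set v in E | degree H v == 1].
exists [set v | [exists E in H, [pick u in priv E] == Some v]].
apply/forall_inP => E HE; apply/cards1P.
case Ev: [pick u in priv E] => [v|]; last first.
  have /card_gt0P[v] : 0 < #|priv E| by apply: ltnW (forall_inP redH E HE).
  by move: Ev; case: pickP => // no_v _; rewrite no_v.
have [vE deg1v] : v \in E /\ degree H v == 1.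
  by move: Ev; case: pickP => // v' + [e]; rewrite e inE => /andP[].
exists v; apply/setP => u; rewrite !inE.
apply/andP/eqP => [[/exists_inP[E' HE'] e uE]|->].
  have [uE' deg1u] : u \in E' /\ degree H u == 1.
    by move: e; case: pickP => // u' + /eqP[eu]; rewrite eu inE => /andP[].
  have EE' := degree1_edge_eq deg1u HE HE' uE uE'.
  by move: e; rewrite -EE' Ev => /eqP[].
by split=> //; apply/exists_inP; exists E => //; apply/eqP.
Qed.

Lemma sigma_attained (V : finType) (H : {set {set V}}) :
  two_reducible H -> exists2 S, crosscut H S & #|S| = sigma H.
Proof.
move=> /exists_crosscut[S0 cS0].
(* The induction over a list records whether a cross-cut has been met; until then the value is the
   default [#|V|], which no cross-cut exceeds in size. *)
have attained (l : seq {set V}) :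
    (exists2 S, crosscut H S &
       #|S| = \big[minn/#|V|]_(S <- l | crosscut H S) #|S|) \/
    \big[minn/#|V|]_(S <- l | crosscut H S) #|S| = #|V| /\
    forall S, S \in l -> ~~ crosscut H S.
  elim: l => [|S l IH]; first by right; rewrite big_nil.
  rewrite big_cons; case: ifP => cS; last first.
    case: IH => [|[e nl]]; [by left | right; split=> // S'].
    by rewrite inE => /orP[/eqP->|/nl //]; rewrite cS.
  left; case: IH => [[S' cS' e]|[e _]].
    by rewrite -e; case: leqP => _; [exists S | exists S'].
  by exists S => //; rewrite e (minn_idPl (max_card _)).
have [|[_ /(_ S0)]] := attained (index_enum {set V}); first by [].
by rewrite cS0 mem_index_enum => /(_ isT).
Qed.

Lemma card_fibers (X Y : finType) (S : {set X * Y}) K :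
  (forall a, #|[set y | (a, y) \in S]| <= K) -> #|S| <= #|X| * K.
Proof.
move=> leK; rewrite -sum1_card.
rewrite (eq_bigl (fun u => predT u.1 && ((u.1, u.2) \in S))); last by case.
rewrite -(pair_big_dep predT (fun a y => (a, y) \in S) (fun _ _ => 1)) /=.
rewrite -sum_nat_const; apply: leq_sum => a _.
by rewrite sum1_card -cardsE leK.
Qed.

Lemma card_ffun_family_le (I W : finType) (C : I -> {set W}) q :
  (forall i, #|C i| <= q) -> #|family C| <= q ^ #|I|.
Proof.
move=> leq; rewrite card_family cardE.
rewrite /image_mem; elim: (enum I) => //= i l IH.
by rewrite expnS leq_mul.
Qed.

(** Over a fixed [(p, B)] each coordinate of the colour takes at most [q] values, so at most [q ^ k]
    colours occur. *)
Lemma card_shadow_colored_omissions (m k : nat) (W : finType)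
    (c : {ffun 'I_m.+1 -> W} -> {ffun 'I_k -> W})
    (A : {set {ffun 'I_m.+1 -> W}}) q :
    (forall p j d, d \in A ->
       #|(fun d => c d j) @: [set d' in A | omit p d' == omit p d]| <= q) ->
  #|shadow (colored_omissions c) A| <= m.+1 * #|W| ^ m * q ^ k.
Proof.
move=> leq.
have -> : m.+1 * #|W| ^ m = #|{: 'I_m.+1 * {ffun 'I_m -> W}}|.
  by rewrite card_prod card_ffun !card_ord.
rewrite -[in q ^ k](card_ord k); apply: card_fibers => -[p B].
case: (set_0Vmem [set x | (p, B, x) \in shadow (colored_omissions c) A]).
  by move->; rewrite cards0.
case=> x; rewrite inE => /bigcupP[d Ad].
rewrite in_colored_omissions => /andP[/eqP dB _].
pose C j := (fun d => c d j) @: [set d' in A | omit p d' == omit p d].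
rewrite (leq_trans _ (card_ffun_family_le (C := C) _)) => [//||j]; last first.
  exact: leq.
apply/subset_leq_card/subsetP => y; rewrite inE => /bigcupP[d' Ad'].
rewrite in_colored_omissions => /andP[/eqP d'B /eqP<-].
apply/familyP => j; apply: (imset_f (fun d => c d j)).
by rewrite inE Ad' dB d'B eqxx.
Qed.

(** * Bounds for a fixed [H]-free family *)

Section UpperBound.

Variables (V W : finType) (m : nat) (H : {set {set V}}) (s : seq {set V}).
Variables (S : {set V}) (F : {set {set W}}).
Hypothesis sH : s =i H.
Hypothesis uniq_s : uniq s.
Hypothesis unifH : uniform m.+2 H.
Hypothesis tree_s : forall i : nat, 0 < i < size s ->
  exists2 a : nat, a < i &
    nth set0 s i :&: \bigcup_(j < i) nth set0 s j \subset nth set0 s a.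
Hypothesis redH : two_reducible H.
Hypothesis crossS : crosscut H S.
Hypothesis leVW : #|V| <= #|W|.
Hypothesis unifF : uniform m.+2 F.
Hypothesis notH : ~~ contains F H.

Let k := #|S|.
Let v := #|V|.

(** Deleting facets of degree at most [v] must exhaust [F'], since a nonempty remainder would
    contain [H]. *)
Lemma card_le_shadow (F' : {set {set W}}) : F' \subset F ->
  #|F'| <= v * #|shadow (facets m.+1) F'|.
Proof.
move=> sF'; have [F2 sF2 [le2 deg2]] := remove_low_degree (facets m.+1) v F'.
have [F2_0|F2_neq0] := eqVneq F2 set0.
  by move: le2; rewrite F2_0 cards0 /shadow big_set0 cards0 muln0 addn0.
have sF2F := subset_trans sF2 sF'.
case/negP: notH; apply: (containsS sF2F).
have unifF2 := uniformS sF2F unifF.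
exact: contains_of_large_degrees sH unifH tree_s leVW unifF2 F2_neq0 deg2.
Qed.

(** The second summand pays for the dichotomy over the [m.+1 * k] pairs of position and index. In
    what survives each extension vertex has at most [2 * v] values per class, and deleting coloured
    omissions of degree at most [v + k] exhausts it: this is the first summand. *)
Lemma card_colored_le (G : {set {ffun 'I_m.+1 -> W}})
    (c : {ffun 'I_m.+1 -> W} -> {ffun 'I_k -> W}) :
    (forall d, d \in G -> injective d) ->
    (forall d, d \in G -> injective (c d)) ->
    (forall d j, d \in G -> c d j \notin [set d i | i : 'I_m.+1]) ->
    (forall d j, d \in G -> c d j |: [set d i | i : 'I_m.+1] \in F) ->
  #|G| <= (v + k) * (m.+1 * #|W| ^ m * (2 * v) ^ k)
          + m.+1 * k * (v * (m.+1 * #|W| ^ m)).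
Proof.
move=> injG cG nG FG.
pose b (pj : 'I_m.+1 * 'I_k) := @omit m W pj.1.
have [G1 sG1 []] := spread_dichotomy_seq (@omissions m W) b
    (fun pj d => c d pj.2) v (2 * v) (enum {: 'I_m.+1 * 'I_k}) G.
  case=> -[p j] spG1; case/negP: notH; have /subsetP sG := sG1.
  by apply: (contains_of_spread sH uniq_s unifH tree_s leVW
               _ _ _ redH (leqnn _) spG1) => d; auto.
move=> [leG qG1].
rewrite -cardE card_prod !card_ord in leG.
have leSh : #|shadow (@omissions m W) G| <= m.+1 * #|W| ^ m.
  rewrite (leq_trans (max_card _)) // card_prod card_ffun !card_ord.
  exact: leqnn.
rewrite (leq_trans leG) // leq_add ?leq_mul //.
have [G2 sG2 [leG1 degG2]] :=
  remove_low_degree (colored_omissions c) (v + k) G1.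
have [G2_0|G2_neq0] := eqVneq G2 set0.
  move: leG1; rewrite G2_0 cards0 /shadow big_set0 cards0 muln0 addn0 add0n.
  move/leq_trans; apply.
  rewrite leq_mul2l card_shadow_colored_omissions ?orbT //.
  by move=> p j d Gd; apply: (qG1 (p, j)); rewrite ?mem_enum.
case/negP: notH; have /subsetP sG := subset_trans sG2 sG1.
by apply: (contains_of_colored_degrees sH unifH tree_s leVW
             _ _ _ crossS (erefl k) G2_neq0 degG2) => // d; auto.
Qed.

(** Shadow sets are counted through their injective orderings, each coloured by [k] chosen extension
    vertices. *)
Lemma card_shadow_le (F' : {set {set W}}) : F' \subset F ->
    (forall D, D \in shadow (facets m.+1) F' ->
       k <= #|star (facets m.+1) F' D|) ->
  #|shadow (facets m.+1) F'| <= (v + k) * (m.+1 * #|W| ^ m * (2 * v) ^ k)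
          + m.+1 * k * (v * (m.+1 * #|W| ^ m)).
Proof.
move=> sF' degF'; have /subsetP sF'F := sF'.
pose im (d : {ffun 'I_m.+1 -> W}) := [set d i | i : 'I_m.+1].
pose G := [set d : {ffun 'I_m.+1 -> W} |
             injectiveb d && (im d \in shadow (facets m.+1) F')].
have cardSh D : D \in shadow (facets m.+1) F' -> #|D| = m.+1.
  by case/bigcupP=> E _; rewrite inE => /andP[_ /eqP].
have leShG : #|shadow (facets m.+1) F'| <= #|G|.
  rewrite (leq_trans _ (leq_imset_card im _)) // subset_leq_card //.
  apply/subsetP => D ShD; have cardD := cardSh D ShD.
  have /card_gt0P[w0 _] : 0 < #|D| by rewrite cardD.
  have [|d injd dD] := @exists_injective_ffun 'I_m.+1 W D w0.
    by rewrite cardD card_ord.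
  have imd : im d = D.
    by apply/eqP; rewrite eqEcard dD card_imset // card_ord cardD /=.
  apply/imsetP; exists d => //; rewrite inE imd ShD andbT; exact/injectiveP.
pose ext (d : {ffun 'I_m.+1 -> W}) (c : {ffun 'I_k -> W}) :=
  injectiveb c && [forall j, (c j \notin im d) && (c j |: im d \in F)].
pose c (d : {ffun 'I_m.+1 -> W}) : {ffun 'I_k -> W} :=
    odflt [ffun=> d ord0] [pick c | ext d c].
have cP d : d \in G -> ext d (c d).
  rewrite inE => /andP[/injectiveP injd Shd].
  rewrite /c; case: pickP => // noext.
  have leX := leq_trans (degF' _ Shd)
    (card_star_facets (uniformS sF' unifF) (cardSh _ Shd)).
  rewrite -[leqLHS]card_ord in leX.
  have [c0 injc0 /subsetP c0X] := exists_injective_ffun (d ord0) leX.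
  suff : ext d c0 by rewrite noext.
  apply/andP; split; first exact/injectiveP.
  apply/forallP => j.
  have /c0X : c0 j \in [set c0 x | x : 'I_k] by apply: imset_f.
  by rewrite inE => /andP[-> /sF'F].
apply: (leq_trans leShG); apply: (card_colored_le (c := c)) => [d|d|d j|d j] Gd.
- by move: Gd; rewrite inE => /andP[/injectiveP].
- by have /andP[/injectiveP] := cP d Gd.
- by have /andP[_ /forallP/(_ j)/andP[]] := cP d Gd.
- by have /andP[_ /forallP/(_ j)/andP[]] := cP d Gd.
Qed.

(** Low-degree deletion with threshold [k - 1] yields the main term; the remainder is at most [v]
    times its shadow, which is of order [#|W| ^ m]. *)
Lemma card_free_le :
  #|F| <= (k - 1) * 'C(#|W|, m.+1) +
    v * ((v + k) * (m.+1 * (2 * v) ^ k) + m.+1 * k * (v * m.+1)) * #|W| ^ m.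
Proof.
have [F' sF' [leF degF']] := remove_low_degree (facets m.+1) (k - 1) F.
have leSh : #|shadow (facets m.+1) F| <= 'C(#|W|, m.+1).
  rewrite -card_draws subset_leq_card //; apply/subsetP => D /bigcupP[E _].
  by rewrite !inE => /andP[].
have {degF'} /(card_shadow_le sF') leG D : D \in shadow (facets m.+1) F' ->
    k <= #|star (facets m.+1) F' D|.
  (* Degrees above [k - 1] are at least [k], also when [k] is 0 and the subtraction truncates. *)
  by move/degF'; rewrite subn1; case: (k).
have leF' := card_le_shadow sF'.
apply: leq_trans (leq_trans (leq_addr _ _) leF) _; rewrite addnC leq_add //.
  by rewrite leq_mul2l leSh orbT.
rewrite (leq_trans leF') // -mulnA leq_mul2l (leq_trans leG) ?orbT //.
apply: eq_leq; rewrite [RHS]mulnDl -!mulnA.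
by congr (_ * (_ * _) + _); rewrite mulnC.
Qed.

End UpperBound.

Theorem theorem4p4 (r : nat) (hr : 4 <= r) (V : finType) (H : {set {set V}})
    (treeH : is_rtree r H) (redH : two_reducible H) :
  exists C N : nat, forall n : nat, N <= n ->
    turan_ex r n H <= (sigma H - 1) * 'C(n, r - 1) + C * n ^ (r - 2).
Proof.
case: r hr treeH => [|[|m]] // _ [unifH _ [s [uniq_s sH tree_s]]].
have [S crossS <-] := sigma_attained redH.
(* [C] is read off from [card_free_le] and depends only on [m], [#|V|] and [#|S|]. The threshold
   [#|V|] ensures that all vertices of [H] fit into ['I_n]. *)
eexists; exists #|V| => n leVn; apply/bigmax_leqP => F /andP[unifF notH].
have {}leVn : #|V| <= #|'I_n| by rewrite card_ord.
have := card_free_le sH uniq_s unifH tree_s redH crossS leVn unifF notH.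
rewrite card_ord subn1 [m.+2 - 1]subn1 subn2; apply.
Qed.
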